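(* Let $G$ be a finite group, and let $A$ and $B$ be subnormal supersoluble subgroups of $G$ such that $G=\langle A,B\rangle$. Then $G$ is metanilpotent and has a Sylow tower of supersoluble type. Furthermore, $G$ is supersoluble whenever at least one of the following conditions holds: (1) the residual $G^{\mathcal{A}}$ is nilpotent, where $\mathcal{A}$ is the formation of all finite groups with abelian Sylow subgroups; (2) $\gcd(|A:A'|,|B:B'|)=1$.
   Context: All groups are finite. $\langle A,B\rangle$ denotes the subgroup generated by $A$ and $B$ (it need not equal the product set $AB$). $X'$ denotes the derived (commutator) subgroup of a group $X$, and $|X:Y|$ the index of a subgroup $Y$ in $X$. A subgroup $H$ of $G$ is subnormal if there is a chain $H=H_0\trianglelefteq H_1\trianglelefteq\dots\trianglelefteq H_n=G$. A finite group is supersoluble if it has a series of normal subgroups of the whole group, from $1$ to the whole group, with all factors cyclic. A group $G$ is metanilpotent if it has a nilpotent normal subgroup $N$ with $G/N$ nilpotent. Let $p_1>p_2>\dots>p_r$ be all the distinct primes dividing $|G|$; $G$ has a Sylow tower of supersoluble type if there is a series $1=G_0\le G_1\le\dots\le G_r=G$ of normal subgroups of $G$ such that $G_i/G_{i-1}$ is isomorphic to a Sylow $p_i$-subgroup of $G$ for each $i=1,\dots,r$. $\mathcal{A}$ is the class of all finite groups all of whose Sylow subgroups are abelian (the groups in $\mathcal{A}$ need not be soluble); the $\mathcal{A}$-residual $G^{\mathcal{A}}$ is the smallest normal subgroup $N$ of $G$ such that $G/N\in\mathcal{A}$, i.e. the intersection of all normal subgroups $N$ of $G$ with $G/N\in\mathcal{A}$.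 *)

(* Defs.v *)
From mathcomp Require Import all_boot all_fingroup all_solvable.

Set Implicit Arguments.
Unset Strict Implicit.
Unset Printing Implicit Defensive.

Local Open Scope group_scope.

(* Each term K of the series after 1 is normal in the whole of G, so K / H     *)
(* is a genuine factor group.                                                 *)
Definition supersoluble (gT : finGroupType) (G : {set gT}) : Prop :=
  exists2 s : seq {group gT},
    path [rel H K : {group gT} | [&& H \subset K, K <| G & cyclic (K / H)]]
         1%G s
    & last 1%G s = G :> {set gT}.

Definition metanilpotent (gT : finGroupType) (G : {set gT}) : Prop :=
  exists N : {group gT}, [/\ N <| G, nilpotent N & nilpotent (G / N)].

(* [primes n] is increasing, so [rev] lists the prime divisors of #|G| in     *)
(* decreasing order; with 0-based indexing the factor N i.+1 / N i belongs to *)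
(* the prime of index i. Values of N beyond the length of the list are junk.  *)
Definition supersoluble_Sylow_tower (gT : finGroupType) (G : {set gT}) : Prop :=
  let ps := rev (primes #|G|) in
  exists N : nat -> {group gT},
    [/\ N 0 :=: 1,
        N (size ps) = G :> {set gT},
        forall i, i <= size ps -> N i <| G
      & forall i, i < size ps ->
          N i \subset N i.+1 /\
          exists2 P : {group gT},
            (nth 0 ps i).-Sylow(G) P & N i.+1 / N i \isog P].

Definition abelian_Sylows (gT : finGroupType) (G : {set gT}) : bool :=
  [forall P : {group gT}, Sylow G P ==> abelian P].

Definition abelian_Sylows_residual (gT : finGroupType) (G : {set gT}) :
    {set gT} :=
  \bigcap_(N : {group gT} | (N <| G) && abelian_Sylows (G / N)) N.

(* Main.v *)
(* Let F be the Fitting subgroup of G. Subnormality of A and B gives          *)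
(* A', B' <= F, O_pi(A), O_pi(B) <= O_pi(G) and O_{p',p}(A), O_{p',p}(B) <=   *)
(* O_{p',p}(G). So G/F is generated by abelian subnormal subgroups, hence     *)
(* nilpotent, and G/O_pi(G) is generated by subnormal pi'-subgroups when pi   *)
(* is the set of primes above a given bound, which yields the Sylow tower.    *)
(* Either extra condition makes the nilpotent group G/F abelian. Since        *)
(* a^(p-1) lies in O_{p',p}(A) for a in a supersoluble group A, G/O_{p',p}(G) *)
(* is then abelian of exponent dividing p-1. As F and O_{p',p}(G) centralise  *)
(* every minimal normal p-subgroup M, G acts on M through an abelian group of *)
(* exponent dividing p-1; it acts by scalars of F_p, so |M| = p, and G is     *)
(* supersoluble by induction.                                                 *)

Require Import Defs.
From mathcomp Require Import all_boot all_fingroup all_solvable.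
From mathcomp Require Import ssralg poly matrix mxalgebra mxpoly finalg zmodp.
From mathcomp Require Import mxrepresentation mxabelem finfield.

Set Implicit Arguments.
Unset Strict Implicit.
Unset Printing Implicit Defensive.

Import GRing.Theory.

Local Open Scope group_scope.

(** ['F], ['O_pi] and ['O_{p^', p}] are monotone along subnormal chains ([subnormal_homo]), so
    quotients of [A] and [B] by these subgroups control the quotients of [G]. Three facts about
    supersoluble groups are fed in, each proved by induction along a normal subgroup of prime order:
    [supersoluble_der1_nil], [supersoluble_Hall_pcore] and [supersoluble_expn_pred]. The first
    yields metanilpotency, the second the tower. For supersolubility, the third must pass from [A]
    and [B] to [G]: an exponent bound on generators extends to the abelian group they generate
    ([joing_expn_pred]), so [G / 'F(G)] has to be abelian, and either extra condition ensures this.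
    Schur's lemma then forces minimal normal subgroups to have prime order
    ([minnormal_expn_pred_card]), and [supersoluble_of_expn_pred] inducts. *)

(** * Supersoluble groups: quotients, cyclic extensions, induction *)

Lemma cyclic_quotientP (gT : finGroupType) (H K : {group gT}) :
  H <| K -> reflect (exists2 x, x \in K & H <*> <[x]> = K) (cyclic (K / H)).
Proof.
move=> /andP[sHK nHK]; apply: (iffP cyclicP) => [[xb defKb] | [x Kx defK]].
  have /morphimP[x Nx Kx def_xb]: xb \in K / H by rewrite defKb cycle_id.
  exists x => //; apply/eqP; rewrite eqEsubset join_subG sHK cycle_subG Kx /=.
  rewrite -(quotientSGK nHK) ?joing_subl //.
  by rewrite quotientYidl ?cycle_subG // quotient_cycle // defKb def_xb.
exists (coset H x); have Nx := subsetP nHK x Kx.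
by rewrite -quotient_cycle // -[in LHS]defK quotientYidl ?cycle_subG.
Qed.

Lemma quotient_cyclic_factor (gT : finGroupType) (H K N : {group gT}) :
  H <| K -> K \subset 'N(N) -> cyclic (K / H) -> cyclic (K / N / (H / N)).
Proof.
move=> nsHK nNK /(cyclic_quotientP nsHK)[x Kx defK].
have [sHK _] := andP nsHK; have nNx := subsetP nNK x Kx.
apply/cyclic_quotientP; first exact: quotient_normal.
exists (coset N x); first exact: mem_quotient.
rewrite -quotient_cycle // -quotientY ?cycle_subG ?defK //.
exact: subset_trans nNK.
Qed.

Lemma quotient_supersoluble (gT : finGroupType) (G N : {group gT}) :
  N <| G -> supersoluble G -> supersoluble (G / N).
Proof.
move=> nsNG [s ser_s defG]; have nNG := normal_norm nsNG.
pose f (K : {group gT}) := (K / N)%G.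
have f1: f 1%G = 1%G by apply/val_inj; rewrite /= quotient1.
exists (map f s); last by rewrite -f1 last_map /= defG.
have ns1G: 1%G <| G by apply: normal1.
rewrite -f1; elim: s 1%G ns1G ser_s {defG} => //= K s IHs H nsHG.
case/andP=> /and3P[sHK nsKG cycKH] /(IHs K nsKG)->.
have [sKG _] := andP nsKG.
rewrite quotientS // quotient_normal // andbT /=.
apply: quotient_cyclic_factor => //; last exact: subset_trans nNG.
exact: normalS nsHG.
Qed.

Lemma supersoluble_cyclic_ext (gT : finGroupType) (G N : {group gT}) :
  N <| G -> cyclic N -> supersoluble (G / N) -> supersoluble G.
Proof.
move=> nsNG cycN [s ser_s defG].
pose f (K : {group coset_of N}) := (coset N @*^-1 K)%G.
have f1: f 1%G :=: N by rewrite /= -kerE ker_coset.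
have nsfG (L : {group coset_of N}) : L <| G / N -> f L <| G.
  by rewrite -{2}(quotientGK nsNG) cosetpre_normal.
have nsN (L : {group coset_of N}) : L <| G / N -> N <| f L.
  move=> nsL; apply: normalS nsNG; last exact: normal_sub (nsfG L nsL).
  by rewrite -f1 morphpreS ?sub1G.
(* The extra [1%G] inserts [N] itself as the first term above 1, with factor [N / 1] cyclic. *)
exists (map f (1%G :: s)); last by rewrite /= last_map /= defG quotientGK.
have ns1G: 1%G <| G / N by apply: normal1.
have cycf1: cyclic (f 1%G / 1) by rewrite f1 quotient_cyclic.
rewrite map_cons /= sub1G nsfG //= cycf1 /= {cycf1}.
elim: s 1%G ns1G ser_s {defG f1} => //= K s IHs H nsHG.
case/andP=> /and3P[sHK nsKG cycKH] /(IHs K nsKG)->.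
have sfHK: f H \subset f K by apply: morphpreS.
rewrite sfHK nsfG //= andbT.
have nsfHK: f H <| f K.
  exact: normalS sfHK (normal_sub (nsfG K nsKG)) (nsfG H nsHG).
have sNfH := normal_sub (nsN H nsHG).
rewrite -(isog_cyclic (third_isog sNfH (nsN K nsKG) nsfHK)).
by rewrite /= !cosetpreK.
Qed.

(** Subgroups of the first nontrivial term of the series, a cyclic normal subgroup, are
    characteristic in it. *)
Lemma supersoluble_prime_normal (gT : finGroupType) (A : {group gT}) :
  supersoluble A -> A :!=: 1 -> exists2 N : {group gT}, N <| A & prime #|N|.
Proof.
case=> s ser_s defA ntA.
elim: s ser_s defA => [_ /= defA | H s IHs /=].
  by rewrite -defA eqxx in ntA.
case/andP=> /and3P[_ nsHA cycH] ser_s defA.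
have [H1 | ntH] := eqVneq H 1%G; first by apply: IHs; rewrite H1 in ser_s defA.
have {}cycH: cyclic H by rewrite (isog_cyclic (quotient1_isog H)).
have pr_p: prime (pdiv #|H|) by rewrite pdiv_prime // cardG_gt1.
have [x Hx ox] := Cauchy pr_p (pdiv_dvd _).
exists <[x]>%G; last by rewrite -orderE ox.
by rewrite (char_normal_trans _ nsHA) // sub_cyclic_char // cycle_subG.
Qed.

Lemma prime_normal_supersoluble_ind
    (P : forall gT : finGroupType, {group gT} -> Prop) :
    (forall gT (A : {group gT}), A :=: 1 -> P gT A) ->
    (forall gT (A N : {group gT}),
       N <| A -> prime #|N| -> P (coset_of N) (A / N)%G -> P gT A) ->
  forall gT (A : {group gT}), supersoluble A -> P gT A.
Proof.
move=> P1 Pext gT A; have [n] := ubnP #|A|.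
elim: n gT A => // n IHn gT A leAn ssA.
have [/P1 // | ntA] := eqVneq (A : {set gT}) 1.
have [N nsNA prN] := supersoluble_prime_normal ssA ntA.
apply: (Pext gT A N) => //; apply: IHn; last exact: quotient_supersoluble.
rewrite -ltnS; apply: leq_trans leAn; rewrite ltnS ltn_quotient ?normal_sub //.
by rewrite -cardG_gt1 prime_gt1.
Qed.

(** * Characteristic subgroups along subnormal chains *)

Lemma subnormal_homo (gT : finGroupType) (F : {set gT} -> {set gT}) :
    (forall H K : {group gT}, H <| K -> F H \subset F K) ->
  forall H G : {group gT}, H <|<| G -> F H \subset F G.
Proof.
move=> homoF H G /subnormalP[s + <-].
elim: s H => //= K s IHs H /andP[nsHK /IHs].
exact: subset_trans (homoF _ _ nsHK).
Qed.

Lemma pcore_subnormal pi (gT : finGroupType) (H G : {group gT}) :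
  H <|<| G -> 'O_pi(H) \subset 'O_pi(G).
Proof.
apply: subnormal_homo => {}H K nsHK.
by rewrite pcore_max ?pcore_pgroup ?gFnormal_trans.
Qed.

Lemma nilpotent_subnormal_Fitting (gT : finGroupType) (H G : {group gT}) :
  H <|<| G -> nilpotent H -> H \subset 'F(G).
Proof.
move=> snHG /nilpotent_Fitting {1}<-; move: snHG.
apply: subnormal_homo => {}H K nsHK.
by rewrite Fitting_max ?Fitting_nil ?gFnormal_trans.
Qed.

Lemma pcore_sub_pseries2 pi rho (gT : finGroupType) (G : {group gT}) :
  'O_pi(G) \subset 'O_{pi, rho}(G).
Proof. by rewrite -pseries1; apply: (pseries_sub_catl [:: pi] [:: rho]). Qed.

(** [K] need only be normal in [H]: it still lies in ['O_pi(G)] by subnormality, so [H / 'O_pi(G)]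
    is an image of [H / K]. *)
Lemma pseries2_max pi rho (gT : finGroupType) (G H K : {group gT}) :
    K <| H -> H <| G -> pi.-group K -> rho.-group (H / K) ->
  H \subset 'O_{pi, rho}(G).
Proof.
move=> nsKH nsHG piK rhoHK; have [sHG nHG] := andP nsHG.
have sKO: K \subset 'O_pi(G).
  apply: subset_trans (pcore_subnormal pi (normal_subnormal nsHG)).
  exact: pcore_max.
have nOG : G \subset 'N('O_pi(G)) := gFnorm _ _.
have nOH := subset_trans sHG nOG.
have nO : 'O_{pi, rho}(G) \subset 'N('O_pi(G)).
  exact: subset_trans (gFsub _ _) nOG.
rewrite -(quotientSGK nOH) ?pcore_sub_pseries2 // quotient_pseries2.
rewrite pcore_max ?quotient_normal //.
have /homgP[f /= Ef]: H / 'O_pi(G) \homg H / K.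
  exact: homg_quotientS (normal_norm nsKH) nOH sKO.
by rewrite /= -Ef morphim_pgroup.
Qed.

Lemma pseries2_subnormal pi rho (gT : finGroupType) (H G : {group gT}) :
  H <|<| G -> 'O_{pi, rho}(H) \subset 'O_{pi, rho}(G).
Proof.
apply: (@subnormal_homo _ (pseries [:: pi; rho])) => {}H K nsHK.
apply: (@pseries2_max pi rho _ K _ 'O_pi(H)).
- apply: normalS (gFsub _ _) (pcore_normal _ _).
  exact: pcore_sub_pseries2.
- exact: gFnormal_trans.
- exact: pcore_pgroup.
by rewrite quotient_pseries2 pcore_pgroup.
Qed.

(** * Structure of a supersoluble group *)

(** A Schur-Zassenhaus complement to the central subgroup [N] is normalised by [N] and by itself,
    hence normal. *)
Lemma central_ext_Hall_pcore pi (gT : finGroupType) (G N : {group gT}) :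
    N \subset 'Z(G) -> pi^'.-group N -> pi.-group (G / N) ->
  pi.-Hall(G) 'O_pi(G).
Proof.
rewrite subsetI => /andP[sNG cNG] pi'N piGN; rewrite centsC in cNG.
have nsNG: N <| G by rewrite /normal sNG cents_norm // centsC.
have hallN: pi^'.-Hall(G) N.
  rewrite /pHall sNG pi'N pnatNK /= -card_quotient ?normal_norm //.
have /splitsP[K /complP[tiNK defG]] :=
  SchurZassenhaus_split (pHall_Hall hallN) nsNG.
have sKG: K \subset G by rewrite -defG mulG_subr.
have hallK: pi.-Hall(G) K.
  have oG: (#|N| * #|K|)%N = #|G| by rewrite -(TI_cardMg tiNK) defG.
  rewrite /pHall sKG -divgS // -oG mulnK ?cardG_gt0 //.
  rewrite [pi^'.-nat _]pi'N andbT /pgroup.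
  suff <-: #|G / N| = #|K| by exact: piGN.
  by rewrite card_quotient ?normal_norm // -divgS // -oG mulKn ?cardG_gt0.
have nsKG: K <| G.
  rewrite /normal sKG -defG mulG_subG normG andbT cents_norm //.
  by rewrite centsC (subset_trans sKG).
by rewrite (normal_Hall_pcore hallK).
Qed.

Lemma der1_cent_cyclic (gT : finGroupType) (G N : {group gT}) :
  N <| G -> cyclic N -> G^`(1) \subset 'C(N).
Proof.
move=> /andP[sNG nNG] cycN.
rewrite -ker_conj_aut ker_trivg_morphim (subset_trans (der_sub 1 G) nNG) /=.
rewrite morphim_der // (derG1P _) // (abelianS (Aut_conj_aut _ _)) //.
exact: Aut_cyclic_abelian.
Qed.

(** [A'] acts trivially on [N] because [Aut N] is abelian; thus [A'] is a central extension of
    [(A / N)']. *)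
Lemma supersoluble_der1_nil (gT : finGroupType) (A : {group gT}) :
  supersoluble A -> nilpotent A^`(1).
Proof.
move: gT A; apply: prime_normal_supersoluble_ind => gT A.
  by move->; rewrite (derG1P _) ?nilpotent1 ?abelian1.
move=> N nsNA pr_N nilA'; have [sNA nNA] := andP nsNA.
have sA'A := der_sub 1 A; have nNA' := subset_trans sA'A nNA.
have cNA': A^`(1) \subset 'C(N) := der1_cent_cyclic nsNA (prime_cyclic pr_N).
have sZ: N :&: A^`(1) \subset 'Z(A^`(1)).
  by rewrite subsetI subsetIr (subset_trans (subsetIl _ _)) // centsC.
rewrite -quotient_center_nil.
have nilA'I: nilpotent (A^`(1) / (N :&: A^`(1))).
  by rewrite (isog_nil (second_isog nNA')) /= quotient_der.
have /homgP[f <-]: A^`(1) / 'Z(A^`(1)) \homg A^`(1) / (N :&: A^`(1)).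
  apply: homg_quotientS sZ; first exact: normsI nNA' (normG _).
  exact: normal_norm (center_normal _).
exact: morphim_nil.
Qed.

Lemma index_cent_cyclic (gT : finGroupType) (G N : {group gT}) :
  cyclic N -> G \subset 'N(N) -> #|G : 'C(N)| %| totient #|N|.
Proof.
move=> cycN nNG; rewrite -(card_Aut_cyclic cycN) -ker_conj_aut.
rewrite -[G in #|G : _|](setIidPr nNG) -card_morphim.
exact/cardSg/Aut_conj_aut.
Qed.

Lemma expg_totient_cent (gT : finGroupType) (N : {group gT}) x :
  cyclic N -> x \in 'N(N) -> x ^+ totient #|N| \in 'C(N).
Proof.
move=> cycN nNx; rewrite -ker_conj_aut; apply/kerP; first exact: groupX.
rewrite morphX // -(card_Aut_cyclic cycN) expg_cardG //.
by have /subsetP-> // := Aut_conj_aut N 'N(N); apply: mem_morphim.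
Qed.

Lemma supersoluble_Hall_pcore n (gT : finGroupType) (A : {group gT}) :
  supersoluble A -> [pred q | n < q].-Hall(A) 'O_[pred q | n < q](A).
Proof.
set pi := [pred q | n < q]; move: gT A.
apply: prime_normal_supersoluble_ind => gT A.
  by move->; rewrite (trivgP (pcore_sub _ _)) /pHall subxx pgroup1 indexgg.
move=> N nsNA prN hallAN; have [sNA nNA] := andP nsNA.
have [piN | pi'N] := boolP (pi #|N|).
  have {}piN: pi.-group N by rewrite /pgroup pnatE.
  have nsNO: N <| 'O_pi(A).
    by rewrite (normalS _ (pcore_sub _ _) nsNA) ?pcore_max.
  by move: hallAN; rewrite /= (pquotient_pcore nsNA piN) pquotient_pHall.
pose D := (coset N @*^-1 'O_pi(A / N))%G.
have nsDA: D <| A by rewrite -(quotientGK nsNA) cosetpre_normal pcore_normal.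
have sND: N \subset D by rewrite -{1}(ker_coset N) kerE morphpreS ?sub1G.
have piDN: pi.-group (D / N) by rewrite /= cosetpreK pcore_pgroup.
have pi'AD: pi^'.-nat #|A : D|.
  rewrite -[A in #|A : _|](quotientGK nsNA) index_cosetpre.
  by have /and3P[] := hallAN.
suff hallD: pi.-Hall(D) 'O_pi(D).
  have hallA: pi.-Hall(A) 'O_pi(D).
    have [sOD piO pi'DO] := and3P hallD; have [sDA _] := andP nsDA.
    rewrite /pHall (subset_trans sOD) //= piO -(Lagrange_index sDA sOD).
    by rewrite pnatM pi'AD.
  by rewrite (normal_Hall_pcore hallA) ?gFnormal_trans.
(* All primes in pi exceed #|N|, so the pi-group D / N centralises N. *)
apply: central_ext_Hall_pcore (piDN); last by rewrite /pgroup pnatE.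
rewrite subsetI sND centsC -indexg_eq1.
have nND: D \subset 'N(N) := subset_trans (normal_sub nsDA) nNA.
have piDC: pi.-nat #|D : 'C(N)|.
  apply: pnat_dvd piDN; rewrite card_quotient //.
  rewrite -[X in X %| _]indexgI indexgS //.
  by rewrite subsetI sND; apply: cyclic_abelian (prime_cyclic prN).
have := index_cent_cyclic (prime_cyclic prN) nND.
rewrite totient_prime // => dvdDC; apply: contraR pi'N => ntDC.
have /pdivP[r pr_r dvd_r]: 1 < #|D : 'C(N)|.
  by rewrite ltn_neqAle eq_sym ntDC indexg_gt0.
have pi_r: r \in \pi(#|D : 'C(N)|) by rewrite mem_primes pr_r indexg_gt0.
apply: leq_trans (pnatPpi piDC pi_r : n < r) _.
rewrite (leq_trans (dvdn_leq _ dvd_r)) // (leq_trans (dvdn_leq _ dvdDC)) //.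
  by rewrite -subn1 subn_gt0 prime_gt1.
exact: leq_pred.
Qed.

(** This encodes that chief [p]-factors have order [p], with automorphism group of order [p - 1]. *)
Lemma supersoluble_expn_pred (p : nat) (gT : finGroupType) (A : {group gT}) :
  prime p -> supersoluble A ->
  {in A, forall x, x ^+ p.-1 \in 'O_{p^', p}(A)}.
Proof.
move=> pr_p; move: gT A; apply: prime_normal_supersoluble_ind => gT A.
  by move=> -> x /set1P->; rewrite expg1n group1.
move=> N nsNA prN expAN x Ax; have [sNA nNA] := andP nsNA.
pose D := (coset N @*^-1 'O_{p^', p}(A / N))%G.
have nsDA: D <| A by rewrite -(quotientGK nsNA) cosetpre_normal pseries_normal.
have sND: N \subset D by rewrite -{1}(ker_coset N) kerE morphpreS ?sub1G.
have Nx := subsetP nNA x Ax.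
have Dx: x ^+ p.-1 \in D.
  rewrite mem_morphpre ?groupX // morphX //.
  exact: expAN (mem_quotient _ Ax).
pose E := (coset N @*^-1 'O_p^'(A / N))%G.
have nsEA: E <| A by rewrite -(quotientGK nsNA) cosetpre_normal pcore_normal.
have sNE: N \subset E by rewrite -{1}(ker_coset N) kerE morphpreS ?sub1G.
have sED: E \subset D by rewrite morphpreS // pcore_sub_pseries2.
have nNE: E \subset 'N(N) := subset_trans (normal_sub nsEA) nNA.
have p'EN: p^'.-group (E / N) by rewrite /= cosetpreK pcore_pgroup.
have pDE: p.-nat #|D : E|.
  rewrite index_cosetpre -card_quotient; last first.
    by rewrite (subset_trans (pseries_sub _ _)) ?gFnorm.
  by rewrite quotient_pseries2 -/(pgroup _ _) pcore_pgroup.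
have [defp | neq_p] := eqVneq #|N| p; last first.
  (* Here [N] is a [p']-group, hence so is [E], and [D] itself lies in ['O_{p^', p}(A)]. *)
  apply: subsetP Dx.
  have nsED: E <| D := normalS sED (normal_sub nsDA) nsEA.
  apply: (@pseries2_max _ _ _ _ _ E) => //.
    by rewrite -(pquotient_pgroup _ nNE) // /pgroup pnatE // !inE.
  by rewrite /pgroup card_quotient // normal_norm.
(* Aut N has order p - 1, so x ^+ p.-1 lies in C = 'C_D(N), and N is a       *)
(* central p-subgroup of C, hence a direct factor of F, where F / N is a     *)
(* normal p'-subgroup of C / N.                                              *)
have cNx: x ^+ p.-1 \in 'C(N).
  by rewrite -(totient_prime pr_p) -defp expg_totient_cent // prime_cyclic.
pose C := (D :&: 'C(N))%G; pose F := (E :&: 'C(N))%G.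
have nsCNA: 'C_A(N) <| A.
  by rewrite /normal subsetIl normsI ?normG ?norms_cent.
have nsFA: F <| A.
  by rewrite /F /= -(setIidPl (normal_sub nsEA)) -setIA normalI.
have nsCA: C <| A.
  by rewrite /C /= -(setIidPl (normal_sub nsDA)) -setIA normalI.
have sFC: F \subset C by rewrite setSI.
have cNN: N \subset 'C(N) by apply: cyclic_abelian (prime_cyclic prN).
have sNF: N \subset F by rewrite subsetI sNE.
have hallF: p^'.-Hall(F) 'O_p^'(F).
  apply: (@central_ext_Hall_pcore _ _ _ N).
  - by rewrite subsetI sNF centsC subsetIr.
  - by rewrite /pgroup pnatNK defp pnat_id.
  - by apply: pgroupS p'EN; rewrite quotientS ?subsetIl.
have pCF: p.-nat #|C : F|.
  have nEC: C \subset 'N(E).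
    exact: subset_trans (normal_sub nsCA) (normal_norm nsEA).
  have -> : F :=: C :&: E by rewrite /F /= setIAC (setIidPr sED).
  rewrite indexgI -indexMg -norm_joinEr //; apply: pnat_dvd pDE.
  by rewrite indexSg ?joing_subl // join_subG sED subsetIl.
have /and3P[sKF p'K pFK] := hallF.
have nsKC: 'O_p^'(F) <| C.
  by apply: gFnormal_trans; apply: normalS nsFA; rewrite ?(normal_sub nsCA).
have: x ^+ p.-1 \in C by apply/setIP.
apply: subsetP; apply: (@pseries2_max _ _ _ _ _ 'O_p^'(F)) => //.
rewrite /pgroup card_quotient ?normal_norm // -(Lagrange_index sFC sKF).
by move: pFK; rewrite pnatNK pnatM pCF => ->.
Qed.

(** * Minimal normal subgroups: centralisers and linear action *)

Lemma minnormal_cent_or_comm (gT : finGroupType) (G M D : {group gT}) :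
  minnormal M G -> D <| G -> D \subset 'C(M) \/ [~: M, D] = M.
Proof.
case/mingroupP=> /andP[ntM nMG] minM /andP[sDG nDG].
have nMD := subset_trans sDG nMG.
have [cMD | ntMD] := eqVneq [~: M, D] 1.
  by left; rewrite centsC; apply/commG1P.
right; apply: minM; last by rewrite commg_subl.
by rewrite ntMD normsR.
Qed.

(** Otherwise [[M, F] = M] with [M] inside the nilpotent group [F], where such a commutator must be
    proper. *)
Lemma minnormal_cent_Fitting (gT : finGroupType) (G M : {group gT}) :
  minnormal M G -> M \subset G -> 'F(G) \subset 'C(M).
Proof.
move=> minM sMG; have [/andP[ntM nMG] _] := mingroupP minM.
have [//| defM] := minnormal_cent_or_comm minM (Fitting_normal G).
have sMF: M \subset 'F(G).
  by rewrite -defM commg_subr (subset_trans sMG) ?gFnorm.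
have nMF: 'F(G) \subset 'N_('F(G))(M).
  by rewrite subsetI subxx (subset_trans (Fitting_sub G)).
have := nil_comm_properl (Fitting_nil G) sMF ntM nMF.
by rewrite defM properxx.
Qed.

(** The same argument runs in the [p]-group [D / L], where [M] survives because [L] is a
    [p']-group. *)
Lemma minnormal_cent_pseries2 (p : nat) (gT : finGroupType) (G M : {group gT}) :
    minnormal M G -> M \subset G -> p.-group M ->
  'O_{p^', p}(G) \subset 'C(M).
Proof.
set D := 'O_{p^', p}(G); set L := 'O_p^'(G) => minM sMG pM.
have [/andP[ntM nMG] _] := mingroupP minM.
have nsDG: D <| G := pseries_normal _ G.
have [//| defM] := minnormal_cent_or_comm minM nsDG.
have sDG: D \subset G by apply: pseries_sub.
have sMD: M \subset D.
  by rewrite -defM commg_subr (subset_trans sMG) ?gFnorm.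
have nLG: G \subset 'N(L) by apply: gFnorm.
have ntML: M / L != 1.
  rewrite -subG1 quotient_sub1 ?(subset_trans sMG nLG) //.
  apply: contra ntM => sML; rewrite -subG1 -(setIidPr sML).
  by rewrite coprime_TIg // coprime_sym (pnat_coprime pM (pcore_pgroup _ _)).
have nilDL: nilpotent (D / L).
  by rewrite quotient_pseries2; apply: pgroup_nil (pcore_pgroup p _).
have nMDL: D / L \subset 'N_(D / L)(M / L).
  by rewrite subsetI subxx quotient_norms // (subset_trans sDG).
have := nil_comm_properl nilDL (quotientS _ sMD) ntML nMDL.
by rewrite -quotientR ?(subset_trans _ nLG) // defM properxx.
Qed.

Section LinearAction.

Local Open Scope ring_scope.

(** By Schur, if [A] is not scalar, all the [A - a] with [a] in [F] are invertible, and so is their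
    product. *)
Lemma mx_irr_cent_scalar (F : finFieldType) (gT : finGroupType)
    (G : {group gT}) n (rG : mx_representation F G n.+1) (A : 'M_n.+1) :
    mx_irreducible rG -> centgmx rG A -> A ^+ #|F| = A ->
  is_scalar_mx A.
Proof.
move=> irrG cGA AF; apply: contraT => nscalA.
have unitA a: A - a%:M \in unitmx.
  apply: (mx_Schur irrG); last first.
    rewrite subr_eq0; apply: contraNneq nscalA => ->.
    exact: scalar_mx_is_scalar.
  apply/centgmxP=> y Gy; rewrite mulmxBl mulmxBr scalar_mxC.
  by rewrite (centgmxP cGA).
have: horner_mx A (\prod_(a : F) ('X - a%:P)) \in unitmx.
  rewrite rmorph_prod /=.
  apply: (big_ind (fun B => B \in unitmx)) => [|B C|a _].
  - exact: unitmx1.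
  - by rewrite unitmx_mul => -> ->.
  by rewrite rmorphB /= horner_mx_X horner_mx_C.
(* The product is 'X^#|F| - 'X, which vanishes at A. *)
rewrite -finField_genPoly rmorphB rmorphXn /= horner_mx_X AF subrr.
by rewrite unitmxE det0 unitr0.
Qed.

Lemma minnormal_expn_pred_card p (gT : finGroupType) (G M : {group gT}) :
    minnormal M G -> p.-abelem M -> (G^`(1) \subset 'C(M))%g ->
    {in G, forall x, (x ^+ p.-1)%g \in 'C(M)%g} ->
  #|M| = p.
Proof.
move=> minM abelM cMG' expG; have [/andP[ntM nMG] _] := mingroupP minM.
have [p_pr _ _] := pgroup_pdiv (abelem_pgroup abelM) ntM.
pose rG := abelem_repr abelM ntM nMG.
have irr_rG: mx_irreducible rG by apply/abelem_mx_irrP.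
have [n_gt0 irrG] := (mx_irrP rG).1 irr_rG.
have ker_rG x : x \in G -> x \in 'C(M)%g -> rG x = 1%:M.
  move=> Gx cMx; apply/row_matrixP=> i; apply: (@rVabelem_inj _ _ _ abelM ntM).
  rewrite rowE rVabelemJ // row1 /conjg.
  by rewrite -(centP cMx) ?mem_rVabelem // mulKg.
have cGG x y : x \in G -> y \in G -> rG x *m rG y = rG y *m rG x.
  move=> Gx Gy; rewrite -!repr_mxM //.
  rewrite (commgC x y) [LHS]repr_mxM ?groupM ?groupV //.
  suff cMxy: [~ x, y]%g \in 'C(M)%g.
    by rewrite (ker_rG _ _ cMxy) ?mulmx1 ?groupR.
  by apply: (subsetP cMG'); rewrite derg1 mem_commg.
have scal_rG x : x \in G -> is_scalar_mx (rG x).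
  move=> Gx; have rGxp : rG x ^+ p = rG x.
    have xp: (x ^+ p = x ^+ p.-1 * x)%g by rewrite -expgSr prednK ?prime_gt0.
    rewrite -repr_mxX // xp repr_mxM ?groupX //.
    by rewrite (ker_rG _ _ (expG x Gx)) ?groupX //= mul1mx.
  apply: (mx_irr_cent_scalar irr_rG); last by rewrite card_Fp.
  by apply/centgmxP=> y Gy; rewrite cGG.
(* As [G] acts by scalars, any line is a submodule, so by irreducibility it is all of [M]. *)
pose U := <<delta_mx 0 (Ordinal n_gt0) : 'rV['F_p]_('dim M)>>%MS.
have rankU: \rank U = 1%N by rewrite genmxE mxrank_delta.
have modU: mxmodule rG U.
  apply/mxmoduleP=> x Gx; have /is_scalar_mxP[a ->] := scal_rG x Gx.
  by rewrite scalar_mxC submxMl.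
have := irrG U modU; rewrite -mxrank_eq0 rankU => /(_ isT)/eqP.
rewrite rankU (dim_abelemE abelM ntM) => dim1.
by rewrite (card_pgroup (abelem_pgroup abelM)) -dim1 expn1.
Qed.

End LinearAction.

(** All three hypotheses pass to quotients, so it suffices to find one normal subgroup of prime
    order. *)
Lemma supersoluble_of_expn_pred (gT : finGroupType) (G : {group gT}) :
    solvable G -> G^`(1) \subset 'F(G) ->
    (forall p, prime p -> {in G, forall x, x ^+ p.-1 \in 'O_{p^', p}(G)}) ->
  supersoluble G.
Proof.
have [n] := ubnP #|G|; elim: n gT G => // n IHn gT G leGn solG sG'F expG.
have [G1 | ntG] := eqVneq (G : {set gT}) 1; first by exists [::].
have [M minM sMG] := minnormal_exists ntG (normG G).
have [nMG ntM /is_abelemP[p pr_p abelM]] := minnormal_solvable minM sMG solG.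
have nsMG: M <| G by apply/andP.
have oM: #|M| = p.
  apply: (minnormal_expn_pred_card minM abelM).
    exact: subset_trans (minnormal_cent_Fitting minM sMG).
  move=> x Gx; have := expG p pr_p x Gx.
  exact/subsetP/minnormal_cent_pseries2/(abelem_pgroup abelM).
apply: (supersoluble_cyclic_ext nsMG); first by rewrite prime_cyclic ?oM.
apply: IHn; first 1 last.
- exact: quotient_sol.
- rewrite -quotient_der //; apply: subset_trans (quotientS _ sG'F) _.
  exact: morphim_Fitting.
- move=> q pr_q _ /morphimP[x Nx Gx ->]; rewrite -morphX //.
  apply: (subsetP (morphim_pseries _ _ _)); apply: mem_quotient.
  exact: expG.
by rewrite -ltnS; apply: leq_trans leGn; rewrite ltnS ltn_quotient.
Qed.

(** * Groups generated by two subnormal subgroups, and the Sylow tower *)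

Lemma quotient_joing (gT : finGroupType) (G A B K : {group gT}) :
  G :=: A <*> B -> G \subset 'N(K) -> G / K = A / K <*> (B / K).
Proof.
move=> defG; rewrite {1 2}defG join_subG => /andP[nKA nKB].
by rewrite quotientY.
Qed.

Lemma quotient_joing_nil (gT : finGroupType) (G A B : {group gT}) :
    A <|<| G -> B <|<| G -> G :=: A <*> B ->
    A^`(1) \subset 'F(G) -> B^`(1) \subset 'F(G) ->
  nilpotent (G / 'F(G)).
Proof.
move=> snA snB defG sA'F sB'F; have nFG: G \subset 'N('F(G)) by apply: gFnorm.
have sub_nil (H : {group gT}) : H <|<| G -> H^`(1) \subset 'F(G) ->
    H / 'F(G) \subset 'F(G / 'F(G)).
  move=> snH sH'F; apply: nilpotent_subnormal_Fitting.
    exact: quotient_subnormal.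
  exact/abelian_nil/sub_der1_abelian.
apply: nilpotentS (Fitting_nil (G / 'F(G))).
suff: A / 'F(G) <*> (B / 'F(G)) \subset 'F(G / 'F(G)).
  by rewrite -(quotient_joing defG nFG).
by rewrite join_subG !sub_nil.
Qed.

(** Modulo ['O_pi(G)], both [A] and [B] become subnormal [pi']-groups, so they generate a
    [pi']-group. *)
Lemma joing_subnormal_Hall_pcore pi (gT : finGroupType) (G A B : {group gT}) :
    A <|<| G -> B <|<| G -> G :=: A <*> B ->
    pi.-Hall(A) 'O_pi(A) -> pi.-Hall(B) 'O_pi(B) ->
  pi.-Hall(G) 'O_pi(G).
Proof.
move=> snA snB defG hallA hallB; set P := 'O_pi(G).
have nPG: G \subset 'N(P) by apply: gFnorm.
have sub_pi' (H : {group gT}) : H <|<| G -> pi.-Hall(H) 'O_pi(H) ->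
    H / P \subset 'O_pi^'(G / P).
  move=> snH /and3P[_ _ pi'H]; have nPH := subset_trans (subnormal_sub snH) nPG.
  have pi'HP: pi^'.-group (H / P).
    apply: pnat_dvd pi'H; rewrite -card_quotient ?gFnorm // card_homg //.
    by apply: homg_quotientS; rewrite ?gFnorm ?pcore_subnormal.
  rewrite -(pcore_pgroup_id pi'HP); apply: pcore_subnormal.
  exact: quotient_subnormal.
rewrite /pHall pcore_sub pcore_pgroup -card_quotient //=.
apply: pgroupS (pcore_pgroup pi^' (G / P)).
suff: A / P <*> (B / P) \subset 'O_pi^'(G / P).
  by rewrite -(quotient_joing defG nPG).
by rewrite join_subG !sub_pi'.
Qed.

Lemma Hall_pcore_supersoluble_Sylow_tower (gT : finGroupType) (G : {group gT}) :
    (forall n, [pred q | n < q].-Hall(G) 'O_[pred q | n < q](G)) ->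
  supersoluble_Sylow_tower G.
Proof.
move=> hallO; rewrite /supersoluble_Sylow_tower; set ps := rev _.
(* The strict bound makes term 0 trivial; past the end, the default 0 admits every prime and gives
   [G]. *)
pose pi i : nat_pred := [pred q | nth 0 ps i < q].
have ps_lt i j : i < j -> i < size ps -> nth 0 ps j < nth 0 ps i.
  move=> ltij lti; have [ltj | gej] := ltnP j (size ps).
    have: sorted gtn ps by rewrite rev_sorted sorted_primes.
    move/(sorted_ltn_nth (rev_trans ltn_trans) 0); exact.
  rewrite (nth_default _ gej); have: nth 0 ps i \in primes #|G|.
    by rewrite -mem_rev mem_nth.
  by rewrite mem_primes => /and3P[/prime_gt0].
have memps q : q \in \pi(G) -> exists2 i, i < size ps & q = nth 0 ps i.
  by rewrite -[q \in _]mem_rev => /(nthP 0)[i lti <-]; exists i.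
have ps_le i j : j <= i -> nth 0 ps i <= nth 0 ps j.
  rewrite leq_eqVlt => /predU1P[-> // | ltji].
  have [/(ps_lt _ _ ltji)/ltnW // | gej] := ltnP j (size ps).
  by rewrite nth_default // (leq_trans gej) // ltnW.
exists (fun i => 'O_(pi i)(G)%G); split=> [||i _|i lti].
- have pi'G: (pi 0)^'.-group G.
    apply/pgroupP=> q pr_q dvd_q; have [|i _ ->] := memps q.
      by rewrite mem_primes pr_q cardG_gt0.
    by rewrite !inE -leqNgt ps_le.
  rewrite /= -(setIidPl (pcore_sub (pi 0) G)).
  exact/coprime_TIg/(pnat_coprime (pcore_pgroup _ _)).
- apply: pcore_pgroup_id; apply/pgroupP=> q pr_q _.
  by rewrite inE nth_default ?prime_gt0.
- exact: pcore_normal.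
set p := nth 0 ps i.
have sNN: 'O_(pi i)(G) \subset 'O_(pi i.+1)(G).
  by apply: sub_pcore => q; apply: leq_ltn_trans; apply: ps_le.
split=> //; have [P sylP] := Sylow_exists p 'O_(pi i.+1)(G).
exists P; first by apply: subHall_Sylow (hallO _) _ sylP; apply: ps_lt.
have [sPO pP _] := and3P sylP.
have nNO: 'O_(pi i.+1)(G) \subset 'N('O_(pi i)(G)).
  exact: subset_trans (pcore_sub _ _) (gFnorm _ _).
have nNP := subset_trans sPO nNO.
have pNN: p.-group ('O_(pi i.+1)(G) / 'O_(pi i)(G)).
  have [sOG _ pi'GO] := and3P (hallO (nth 0 ps i)).
  apply/pgroupP=> q pr_q dvd_q; rewrite inE /=.
  have piNN := quotient_pgroup 'O_(pi i)(G) (pcore_pgroup (pi i.+1) G).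
  have gtq := pgroupP piNN q pr_q dvd_q.
  rewrite card_quotient // in dvd_q.
  have {}dvd_q := dvdn_trans dvd_q (indexSg sNN (pcore_sub _ _)).
  have leqp := pnatP _ _ pi'GO q pr_q dvd_q.
  have [|j ltj def_q] := memps q.
    by rewrite mem_primes pr_q cardG_gt0 (dvdn_trans dvd_q) ?dvdn_indexg.
  move: gtq leqp; rewrite !inE /= def_q -leqNgt => gtq leqp.
  (* The prime [q] of index [j] exceeds that of index [i.+1] and is at most that of index [i], so
     [j = i]. *)
  have [ltji | ltij | -> //] := ltngtP j i.
    by have := ps_lt j i ltji ltj; rewrite ltnNge leqp.
  by have := ps_le j i.+1 ltij; rewrite leqNgt gtq.
rewrite isog_sym -(pHall_id (quotient_pHall nNP sylP) pNN) quotient_isog //.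
apply: coprime_TIg; apply: pnat_coprime (pcore_pgroup _ _) _.
apply: sub_pgroup pP => q /eqnP->.
by rewrite !inE ltnn.
Qed.

(** * The two conditions make [G / 'F(G)] abelian *)

Lemma nilpotent_abelian_Sylows (gT : finGroupType) (G : {group gT}) :
  nilpotent G -> abelian_Sylows G -> abelian G.
Proof.
move=> nilG /forall_inP abS; rewrite -[G in abelian G]Sylow_gen abelian_gen.
apply/bigcupsP=> P sylP; rewrite centsC; apply/bigcupsP=> Q sylQ.
have [[p _ pP] [q _ qQ]] := (SylowP _ _ sylP, SylowP _ _ sylQ).
have [eq_pq | neq_pq] := eqVneq p q.
  rewrite (nilpotent_Hall_pcore nilG qQ) -eq_pq -(nilpotent_Hall_pcore nilG pP).
  exact: abS.
apply: sub_nilpotent_cent2 nilG (pHall_sub pP) (pHall_sub qQ) _.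
apply: pnat_coprime (pHall_pgroup pP) _.
by apply: sub_pgroup (pHall_pgroup qQ) => r /eqnP->; rewrite !inE eq_sym.
Qed.

Lemma residual_normal (gT : finGroupType) (G : {group gT}) :
  abelian_Sylows_residual G <| G.
Proof.
apply/andP; split.
  apply: (bigcap_inf G); rewrite normal_refl; apply/forall_inP=> P sylP.
  apply: abelianS (abelian1 _); rewrite -(trivg_quotient G).
  by have [p _ /pHall_sub] := SylowP _ _ sylP.
by apply/norms_bigcap/bigcapsP=> N /andP[/normal_norm].
Qed.

(** This serves in place of the fact that [G] modulo its residual has abelian Sylow subgroups. *)
Lemma Sylow_der1_residual (gT : finGroupType) (G P : {group gT}) :
  Sylow G P -> P^`(1) \subset abelian_Sylows_residual G.
Proof.
move=> /SylowP[p pr_p sylP]; apply/bigcapsP=> N /andP[nsNG /forall_inP abGN].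
have nNP := subset_trans (pHall_sub sylP) (normal_norm nsNG).
apply: der1_min => //; apply: (abGN (P / N)%G).
by apply: p_Sylow; apply: quotient_pHall sylP.
Qed.

Lemma der1_Fitting_of_residual (gT : finGroupType) (G : {group gT}) :
    nilpotent (G / 'F(G)) -> nilpotent (abelian_Sylows_residual G) ->
  G^`(1) \subset 'F(G).
Proof.
move=> nilGF nilR; have nFG: G \subset 'N('F(G)) by apply: gFnorm.
have sRF: abelian_Sylows_residual G \subset 'F(G).
  exact: Fitting_max (residual_normal G) nilR.
apply: der1_min => //; apply: nilpotent_abelian_Sylows => //.
apply/forall_inP=> Q /SylowP[p pr_p sylQ]; have [P sylP] := Sylow_exists p G.
have nFP := subset_trans (pHall_sub sylP) nFG.
rewrite (nilpotent_Hall_pcore nilGF sylQ).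
rewrite -(nilpotent_Hall_pcore nilGF (quotient_pHall nFP sylP)).
apply: sub_der1_abelian; apply: subset_trans sRF.
exact: Sylow_der1_residual (p_Sylow sylP).
Qed.

(** The images of [A] and [B] in [G / 'F(G)] are quotients of [A / A'] and [B / B']: abelian, of
    coprime orders, hence commuting in a nilpotent group. *)
Lemma der1_Fitting_of_coprime (gT : finGroupType) (G A B : {group gT}) :
    A \subset G -> B \subset G -> G :=: A <*> B -> nilpotent (G / 'F(G)) ->
    A^`(1) \subset 'F(G) -> B^`(1) \subset 'F(G) ->
    coprime #|A : A^`(1)| #|B : B^`(1)| ->
  G^`(1) \subset 'F(G).
Proof.
move=> sAG sBG defG nilGF sA'F sB'F coAB.
have nFG: G \subset 'N('F(G)) by apply: gFnorm.
apply: der1_min => //.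
rewrite (quotient_joing defG nFG) abelianY !sub_der1_abelian //=.
have dvd_index (H : {group gT}) : H \subset G -> H^`(1) \subset 'F(G) ->
    #|H / 'F(G)| %| #|H : H^`(1)|.
  move=> sHG sH'F; rewrite -card_quotient ?der_norm // card_homg //.
  by apply: homg_quotientS; rewrite ?der_norm // (subset_trans sHG).
apply: sub_nilpotent_cent2 nilGF (quotientS _ sAG) (quotientS _ sBG) _.
by apply: coprime_dvdl (dvd_index A _ _) (coprime_dvdr (dvd_index B _ _) coAB).
Qed.

Lemma Fitting_sub_pseries2 p (gT : finGroupType) (G : {group gT}) :
  'F(G) \subset 'O_{p^', p}(G).
Proof.
apply: (@pseries2_max _ _ _ _ _ 'O_p^'('F(G))) (Fitting_normal G) _ _.
- exact: pcore_normal.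
- exact: pcore_pgroup.
have /and3P[_ _] := nilpotent_pcore_Hall p^' (Fitting_nil G).
by rewrite pnatNK /pgroup card_quotient ?gFnorm.
Qed.

Lemma joing_expn_pred p (gT : finGroupType) (G A B : {group gT}) :
    A <|<| G -> B <|<| G -> G :=: A <*> B -> G^`(1) \subset 'F(G) ->
    {in A, forall x, x ^+ p.-1 \in 'O_{p^', p}(A)} ->
    {in B, forall x, x ^+ p.-1 \in 'O_{p^', p}(B)} ->
  {in G, forall x, x ^+ p.-1 \in 'O_{p^', p}(G)}.
Proof.
move=> snA snB defG sG'F expA expB x Gx; set D := 'O_{p^', p}(G).
have nDG: G \subset 'N(D) by apply: gFnorm.
have abGD: abelian (G / D).
  exact/sub_der1_abelian/(subset_trans sG'F)/Fitting_sub_pseries2.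
have defGD: G / D = <<A / D :|: B / D>>.
  exact: quotient_joing defG nDG.
have expGD: exponent (G / D) %| p.-1.
  have abU: abelian (A / D :|: B / D) by rewrite -abelian_gen -defGD.
  rewrite defGD (abelian_exponent_gen abU).
  apply/exponentP=> _ /setUP[] /morphimP[y Ny Hy ->];
    rewrite -morphX //= coset_id //.
    by apply: subsetP (expA y Hy); apply: pseries2_subnormal.
  by apply: subsetP (expB y Hy); apply: pseries2_subnormal.
have Nx := subsetP nDG x Gx.
apply: coset_idr; first exact: groupX.
by rewrite morphX // (exponentP expGD) // mem_quotient.
Qed.

Theorem theorem1p1 (gT : finGroupType) (G A B : {group gT})
    (snA : A <|<| G) (snB : B <|<| G)
    (ssA : supersoluble A) (ssB : supersoluble B)
    (defG : G :=: A <*> B) :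
  [/\ metanilpotent G,
      supersoluble_Sylow_tower G
    & nilpotent (abelian_Sylows_residual G) \/
        coprime #|A : A^`(1)| #|B : B^`(1)| ->
      supersoluble G].
Proof.
have [sAG sBG] := (subnormal_sub snA, subnormal_sub snB).
have sub_der1 (H : {group gT}) :
  H <|<| G -> supersoluble H -> H^`(1) \subset 'F(G).
  move=> snH ssH; apply: nilpotent_subnormal_Fitting.
    exact: subnormal_trans (normal_subnormal (der_normal 1 H)) snH.
  exact: supersoluble_der1_nil.
have [sA'F sB'F] := (sub_der1 A snA ssA, sub_der1 B snB ssB).
have nilGF := quotient_joing_nil snA snB defG sA'F sB'F.
split=> [||cond].
- by exists 'F(G)%G; rewrite Fitting_normal Fitting_nil.
- apply: Hall_pcore_supersoluble_Sylow_tower => n.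
  by apply: joing_subnormal_Hall_pcore snA snB defG _ _;
    apply: supersoluble_Hall_pcore.
have sG'F: G^`(1) \subset 'F(G).
  case: cond => [nilR | coAB]; first exact: der1_Fitting_of_residual.
  exact: der1_Fitting_of_coprime coAB.
apply: supersoluble_of_expn_pred => // [|p pr_p].
  by rewrite (series_sol (Fitting_normal G)) !nilpotent_sol ?Fitting_nil.
by apply: (joing_expn_pred snA snB defG sG'F); apply: supersoluble_expn_pred.
Qed.
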